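(* Let $r,s,t,u\in\mathbb{R}\setminus\{0\}$ with $s=-r$ and $t=-u$. Then the following inclusions hold and each is strict: (i) $[\mathcal{C}_{f}]\subset B[\mathcal{C}_{f}]$; (ii) $[\mathcal{C}_{f_0}]\subset B[\mathcal{C}_{f_0}]$; (iii) $B[\mathcal{C}_{f}]\subset B(\mathcal{C}_{f})$; (iv) $B[\mathcal{C}_{f_0}]\subset B(\mathcal{C}_{f_0})$.
   Context: $\mathbb{N}=\{0,1,2,\dots\}$; $\Omega$ is the vector space of all complex double sequences $x=(x_{kl})_{k,l\in\mathbb{N}}$. ''$p$-$\lim$'' denotes the limit in Pringsheim's sense (both indices tend to infinity independently). $\mathcal{C}_f$ (almost convergent double sequences) is the set of $x\in\Omega$ for which there is $L\in\mathbb{C}$ with $$p\text{-}\lim_{q,q'\to\infty}\ \sup_{m,n\in\mathbb{N}}\left|\frac{1}{(q+1)(q'+1)}\sum_{k=m}^{m+q}\sum_{l=n}^{n+q'}x_{kl}-L\right|=0,$$ and $\mathcal{C}_{f_0}$ is the set of $x\in\Omega$ for which this holds with $L=0$. $[\mathcal{C}_f]$ (strongly almost convergent double sequences) is the set of $x\in\Omega$ for which there is $L\in\mathbb{C}$ with $$p\text{-}\lim_{q,q'\to\infty}\ \sup_{m,n\in\mathbb{N}}\frac{1}{(q+1)(q'+1)}\sum_{k=m}^{m+q}\sum_{l=n}^{n+q'}|x_{kl}-L|=0,$$ and $[\mathcal{C}_{f_0}]$ is the set of $x\in\Omega$ for which this holds with $L=0$. For $r,s,t,u\in\mathbb{R}\setminus\{0\}$,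 the generalized difference matrix $B=B(r,s,t,u)$ acts by $(Bx)_{mn}=su\,x_{m-1,n-1}+st\,x_{m-1,n}+ru\,x_{m,n-1}+rt\,x_{mn}$, where terms with a negative index are $0$. $B[\mathcal{C}_f]$, $B[\mathcal{C}_{f_0}]$, $B(\mathcal{C}_f)$, $B(\mathcal{C}_{f_0})$ denote the sets of $x\in\Omega$ with $Bx$ in $[\mathcal{C}_f]$, $[\mathcal{C}_{f_0}]$, $\mathcal{C}_f$, $\mathcal{C}_{f_0}$, respectively. *)

(* Defs.v *)
From HB Require Import structures.
From mathcomp Require Import all_boot all_order all_algebra.
From mathcomp Require Import all_classical all_reals all_analysis.
From mathcomp Require Import complex.

Set Implicit Arguments.
Unset Strict Implicit.
Unset Printing Implicit Defensive.

Import Order.TTheory GRing.Theory Num.Theory.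
Import numFieldNormedType.Exports.

Local Open Scope classical_set_scope.
Local Open Scope ring_scope.
Local Open Scope complex_scope.

Definition dseq (R : realType) : Type := nat -> nat -> R[i].

(* The limit is taken in the extended reals because it is applied to suprema
   that may be infinite for some values of the two indices. *)
Definition pringsheim_lim (R : realType) (a : nat -> nat -> \bar R)
    (l : \bar R) : Prop :=
  a p.1 p.2 @[p --> filter_prod \oo \oo] --> l.

Definition sup2 (R : realType) (a : nat -> nat -> R) : \bar R :=
  ereal_sup [set z | exists m n : nat, z = (a m n)%:E].

Definition window_mean (K : unitRingType) (y : nat -> nat -> K)
    (q q' m n : nat) : K :=
  (q.+1 * q'.+1)%N%:R^-1 *
  \sum_(m <= k < (m + q).+1) \sum_(n <= l < (n + q').+1) y k l.

(* The library norm on R[i] is R[i]-valued; [Normc.normc] is the R-valued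
   modulus. *)
Definition almost_conv_to (R : realType) (x : dseq R) (L : R[i]) : Prop :=
  pringsheim_lim
    (fun q q' => sup2 (fun m n => Normc.normc (window_mean x q q' m n - L)))
    0%E.

Definition strongly_almost_conv_to (R : realType) (x : dseq R) (L : R[i]) :
    Prop :=
  pringsheim_lim
    (fun q q' =>
       sup2 (fun m n =>
         window_mean (fun k l => Normc.normc (x k l - L)) q q' m n))
    0%E.

Definition Cf (R : realType) : set (dseq R) :=
  [set x | exists L, almost_conv_to x L].

Definition Cf0 (R : realType) : set (dseq R) :=
  [set x | almost_conv_to x 0].

Definition sCf (R : realType) : set (dseq R) :=
  [set x | exists L, strongly_almost_conv_to x L].

Definition sCf0 (R : realType) : set (dseq R) :=
  [set x | strongly_almost_conv_to x 0].

Definition Bmx (R : realType) (r s t u : R) (x : dseq R) : dseq R :=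
  fun m n =>
    (s * u)%:C * (if (0 < m)%N && (0 < n)%N then x m.-1 n.-1 else 0)
    + (s * t)%:C * (if (0 < m)%N then x m.-1 n else 0)
    + (r * u)%:C * (if (0 < n)%N then x m n.-1 else 0)
    + (r * t)%:C * x m n.

Definition Bdom (R : realType) (r s t u : R) (X : set (dseq R)) :
    set (dseq R) :=
  [set x | X (Bmx r s t u x)].

(* Main.v *)
(* When [s = - r] and [t = - u], [Bmx r s t u] is the scalar [- (r * u)] times
   the mixed difference operator. It kills constants up to the corner entry, and
   shifting a sequence does not increase its uniform window means, so it maps
   sequences strongly almost convergent to any limit into the strongly almost
   null ones. One sequence witnesses all four strict inclusions: x_kl = (-1)^k
   is almost null but not strongly almost convergent; its mixed difference lives
   on the column l = 0, hence is strongly almost null, and x is itself the image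
   under [Bmx] of a double sequence. *)

Require Import Defs.
From mathcomp Require Import all_boot all_order all_algebra.
From mathcomp Require Import all_classical all_reals all_analysis.
From mathcomp Require Import complex.
From mathcomp Require Import ring lra.

Import Order.TTheory GRing.Theory Num.Theory.
Import numFieldNormedType.Exports.

Local Open Scope classical_set_scope.
Local Open Scope ring_scope.

(** * Pringsheim limits of suprema in epsilon form *)

Section PringsheimSup.
Variable R : realType.
Implicit Type a : nat -> nat -> nat -> nat -> R.

(** A supremum is at most [e] exactly when all its terms are, and for nonnegative terms such an
    upper bound also makes it finite, so the extended-real limit reduces to a real one. The larger
    of the two thresholds of a rectangle in the product filter serves both indices. *)
Lemma pringsheim_sup2P a :
  (forall q q' m n, 0 <= a q q' m n) ->
  pringsheim_lim (fun q q' => sup2 (a q q')) 0%E <->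
  (forall e, 0 < e -> exists N, forall q q', (N <= q)%N -> (N <= q')%N ->
    forall m n, a q q' m n <= e).
Proof.
move=> a0; rewrite /pringsheim_lim; split.
- move=> /fine_cvgP[fin /cvgr0Pnorm_le lim] e e0.
  have [[P Q] /= [[N _ NP] [N' _ NQ]] H] := filterI fin (lim e e0).
  exists (maxn N N') => q q'; rewrite !geq_max => /andP[Nq _] /andP[_ Nq'] m n.
  have /= [f le_e] := H (q, q') (conj (NP _ Nq) (NQ _ Nq')).
  rewrite -lee_fin; apply: (@le_trans _ _ (sup2 (a q q'))).
    by apply: ereal_sup_ubound; exists m, n.
  by rewrite -(fineK f) lee_fin (le_trans _ le_e) // ler_norm.
- move=> H.
  have sup_ge0 q q' : (0 <= sup2 (a q q'))%E.
    apply: (@le_trans _ _ (a q q' 0%N 0%N)%:E); first by rewrite lee_fin.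
    by apply: ereal_sup_ubound; exists 0%N, 0%N.
  have sup_le e : 0 < e -> \forall p \near filter_prod \oo \oo,
      (sup2 (a p.1 p.2) <= e%:E)%E.
    move=> /H[N HN]; exists ([set k | (N <= k)%N], [set k | (N <= k)%N]) => /=.
      by split; exact: nbhs_infty_ge.
    move=> [q q'] /= [Nq Nq']; apply/ereal_supP => _ [m [n ->]].
    by rewrite lee_fin HN.
  have fin e p : (sup2 (a p.1 p.2) <= e%:E)%E -> sup2 (a p.1 p.2) \is a fin_num.
    by move=> le_e; rewrite ge0_fin_numE // (le_lt_trans le_e) // ltry.
  apply/fine_cvgP; split.
    by apply: filterS (sup_le 1 ltr01) => p; exact: fin.
  apply/cvgr0Pnorm_le => e e0; apply: filterS (sup_le e e0) => p le_e /=.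
  by rewrite ger0_norm ?fine_ge0 // -lee_fin fineK // (fin e).
Qed.

End PringsheimSup.

(** * Window means: monotonicity, linearity, shifts *)

Section WindowMean.
Variable R : realType.
Implicit Types y z : nat -> nat -> R.

Lemma window_size_gt0 q q' : (0 : R) < (q.+1 * q'.+1)%N%:R^-1.
Proof. by rewrite invr_gt0 ltr0n muln_gt0. Qed.

Lemma le_window_mean y z q q' m n : (forall k l, y k l <= z k l) ->
  window_mean y q q' m n <= window_mean z q q' m n.
Proof.
move=> yz; rewrite ler_pM2l ?window_size_gt0 //.
by apply: ler_sum => k _; exact: ler_sum.
Qed.

Lemma window_mean_ge0 y q q' m n : (forall k l, 0 <= y k l) ->
  0 <= window_mean y q q' m n.
Proof.
move=> y0; apply: mulr_ge0; first exact/ltW/window_size_gt0.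
by apply: sumr_ge0 => k _; exact: sumr_ge0.
Qed.

Lemma window_meanD (K : unitRingType) (y z : nat -> nat -> K) q q' m n :
  window_mean (fun k l => y k l + z k l) q q' m n =
  window_mean y q q' m n + window_mean z q q' m n.
Proof.
rewrite /window_mean -mulrDr -big_split; congr (_ * _).
by apply: eq_bigr => k _; rewrite -big_split.
Qed.

Lemma window_meanZ c y q q' m n :
  window_mean (fun k l => c * y k l) q q' m n = c * window_mean y q q' m n.
Proof.
rewrite /window_mean mulrCA; congr (_ * _); rewrite mulr_sumr.
by apply: eq_bigr => k _; rewrite mulr_sumr.
Qed.

Lemma window_mean_cst (K : numFieldType) (c : K) q q' m n :
  window_mean (fun _ _ => c) q q' m n = c.
Proof.
rewrite /window_mean !sumr_const_nat -!addnS !addKn -mulrnA mulnC.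
by rewrite -[c *+ _]mulr_natl mulKf // pnatr_eq0 muln_eq0.
Qed.

Lemma normc_window_mean_le (x : dseq R) q q' m n :
  Normc.normc (window_mean x q q' m n) <=
  window_mean (fun k l => Normc.normc (x k l)) q q' m n.
Proof.
have normcS (f : nat -> R[i]) a b : Normc.normc (\sum_(a <= k < b) f k) <=
    \sum_(a <= k < b) Normc.normc (f k).
  elim/big_rec2: _ => [|k u v _ uv]; first by rewrite Normc.normc0.
  by rewrite (le_trans (le_normcD _ _)) // lerD2l.
rewrite /window_mean Normc.normcM Normc.normcV.
have -> : Normc.normc ((q.+1 * q'.+1)%N%:R : R[i]) = (q.+1 * q'.+1)%N%:R.
  by rewrite normcMn Normc.normc1.
rewrite ler_pM2l ?window_size_gt0 // (le_trans (normcS _ _ _)) //.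
exact: ler_sum.
Qed.

(** For positive [m] the two sums agree after reindexing. For [m = 0] the padding zero takes one
    place of the window, so the left side lacks the term [f q], which is nonnegative. *)
Lemma sum_shift_le (f : nat -> R) q m : (forall k, 0 <= f k) ->
  \sum_(m <= k < (m + q).+1) (if (0 < k)%N then f k.-1 else 0) <=
  \sum_(m.-1 <= k < (m.-1 + q).+1) f k.
Proof.
move=> f0; case: m => [|m] /=; last by rewrite addSn big_add1.
by rewrite add0n big_nat_recl //= add0r big_nat_recr //= lerDl.
Qed.

Lemma window_mean_shift1_le y q q' m n : (forall k l, 0 <= y k l) ->
  window_mean (fun k l => if (0 < k)%N then y k.-1 l else 0) q q' m n <=
  window_mean y q q' m.-1 n.
Proof.
move=> y0; rewrite ler_pM2l ?window_size_gt0 //.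
rewrite exchange_big [leRHS]exchange_big /=.
by apply: ler_sum => l _; exact: (sum_shift_le (y ^~ l)).
Qed.

Lemma window_mean_shift2_le y q q' m n : (forall k l, 0 <= y k l) ->
  window_mean (fun k l => if (0 < l)%N then y k l.-1 else 0) q q' m n <=
  window_mean y q q' m n.-1.
Proof.
move=> y0; rewrite ler_pM2l ?window_size_gt0 //.
by apply: ler_sum => k _; exact: (sum_shift_le (y k)).
Qed.

(** A window meets the column [l = 0] in at most one entry per row, hence in at most [q.+1] of its
    [q.+1 * q'.+1] entries. *)
Lemma window_mean_col0_le q q' m n :
  window_mean (fun _ l => (l == 0%N)%:R) q q' m n <= q'.+1%:R^-1 :> R.
Proof.
rewrite /window_mean sumr_const_nat -!addnS addKn -[_ *+ q.+1]mulr_natl.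
rewrite natrM invfM mulrACA mulVf ?pnatr_eq0 // mul1r.
rewrite -[leRHS]mulr1 ler_pM2l ?invr_gt0 ?ltr0n //.
case: n => [|n]; first by rewrite add0n big_nat_recl //= big1 ?addr0.
by rewrite addnS addSn big_add1 big1.
Qed.

End WindowMean.

Lemma normc_ge0 (R : realType) (z : R[i]) : 0 <= Normc.normc z.
Proof. by case: z => a b; exact: sqrtr_ge0. Qed.

Lemma natr_inv_small (R : realType) (e : R) : 0 < e ->
  exists N, forall q, (N <= q)%N -> (q.+1%:R^-1 : R) <= e.
Proof.
move=> e0; have [N _ HN] := near_infty_natSinv_lt (PosNum e0).
by exists N => q /HN /ltW.
Qed.

(** * Sequences whose window means tend to 0 uniformly in position *)

Section UniformlyNull.
Variable R : realType.
Implicit Types y z : nat -> nat -> R.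

(** The bound is one-sided because it is applied to nonnegative sequences such as |x - L|; this
    makes domination a direct comparison. *)
Definition uniformly_null y := forall e, 0 < e ->
  exists N, forall q q', (N <= q)%N -> (N <= q')%N ->
    forall m n, window_mean y q q' m n <= e.

Lemma uniformly_null_le y z : (forall k l, y k l <= z k l) ->
  uniformly_null z -> uniformly_null y.
Proof.
move=> yz z0 e /z0[N HN]; exists N => q q' Nq Nq' m n.
by apply: le_trans (HN q q' Nq Nq' m n); exact: le_window_mean.
Qed.

Lemma uniformly_nullD y z : uniformly_null y -> uniformly_null z ->
  uniformly_null (fun k l => y k l + z k l).
Proof.
move=> y0 z0 e e0; have e20 : 0 < e / 2 by rewrite divr_gt0.
have [[N HN] [N' HN']] := (y0 _ e20, z0 _ e20).
exists (maxn N N') => q q'; rewrite !geq_max => /andP[? ?] /andP[? ?] m n.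
by rewrite window_meanD [leRHS]splitr lerD ?HN ?HN'.
Qed.

Lemma uniformly_nullZ c y : 0 < c -> uniformly_null y ->
  uniformly_null (fun k l => c * y k l).
Proof.
move=> c0 y0 e e0; have [|N HN] := y0 (c^-1 * e).
  by rewrite mulr_gt0 ?invr_gt0.
exists N => q q' Nq Nq' m n.
by rewrite window_meanZ -ler_pdivlMl // HN.
Qed.

Lemma uniformly_null_shift1 y : (forall k l, 0 <= y k l) -> uniformly_null y ->
  uniformly_null (fun k l => if (0 < k)%N then y k.-1 l else 0).
Proof.
move=> y_ge0 y0 e /y0[N HN]; exists N => q q' Nq Nq' m n.
by rewrite (le_trans (window_mean_shift1_le _ _ _ _ _ _ _)) // HN.
Qed.

Lemma uniformly_null_shift2 y : (forall k l, 0 <= y k l) -> uniformly_null y ->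
  uniformly_null (fun k l => if (0 < l)%N then y k l.-1 else 0).
Proof.
move=> y_ge0 y0 e /y0[N HN]; exists N => q q' Nq Nq' m n.
by rewrite (le_trans (window_mean_shift2_le _ _ _ _ _ _ _)) // HN.
Qed.

Lemma uniformly_null_col0 : uniformly_null (fun _ l => (l == 0%N)%:R).
Proof.
move=> e /natr_inv_small[N HN]; exists N => q q' _ Nq' m n.
by rewrite (le_trans (window_mean_col0_le _ _ _ _ _)) // HN.
Qed.

Lemma strongly_almost_conv_toP (x : dseq R) L :
  strongly_almost_conv_to x L <->
  uniformly_null (fun k l => Normc.normc (x k l - L)).
Proof.
apply: pringsheim_sup2P => q q' m n.
by apply: window_mean_ge0 => k l; exact: normc_ge0.
Qed.

Lemma almost_conv_toP (x : dseq R) L : almost_conv_to x L <->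
  (forall e, 0 < e -> exists N, forall q q', (N <= q)%N -> (N <= q')%N ->
    forall m n, Normc.normc (window_mean x q q' m n - L) <= e).
Proof. by apply: pringsheim_sup2P => *; exact: normc_ge0. Qed.

Lemma strongly_almost_conv_to_almost (x : dseq R) L :
  strongly_almost_conv_to x L -> almost_conv_to x L.
Proof.
move=> /strongly_almost_conv_toP xL; apply/almost_conv_toP => e /xL[N HN].
exists N => q q' Nq Nq' m n; apply: le_trans (HN q q' Nq Nq' m n).
have -> : window_mean x q q' m n - L =
    window_mean (fun k l => x k l - L) q q' m n.
  by rewrite window_meanD window_mean_cst.
exact: normc_window_mean_le.
Qed.

End UniformlyNull.

Arguments strongly_almost_conv_toP {R x L}.
Arguments almost_conv_toP {R x L}.

(** * The mixed difference of a strongly almost convergent sequence *)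

Section DifferenceMatrix.
Variable R : realType.
Implicit Type x : dseq R.

Lemma BmxE (r u : R) x k l :
  Bmx r (- r) (- u) u x k l = (- (r * u))%:C%C *
    ((if (0 < k)%N && (0 < l)%N then x k.-1 l.-1 else 0)
     - (if (0 < k)%N then x k.-1 l else 0)
     - (if (0 < l)%N then x k l.-1 else 0) + x k l).
Proof. by rewrite /Bmx mulNr mulrN mulNr opprK mulrN !rmorphN /=; ring. Qed.

Lemma normc_alt4_le (a b c d : R[i]) :
  Normc.normc (a - b - c + d) <=
  (Normc.normc a + Normc.normc b) + (Normc.normc c + Normc.normc d).
Proof.
rewrite -addrA (le_trans (le_normcD _ _)) // lerD //.
  by rewrite (le_trans (le_normcD _ _)) // normcN.
by rewrite (le_trans (le_normcD _ _)) // normcN.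
Qed.

Lemma normc_real (a : R) : Normc.normc a%:C%C = `|a|.
Proof. by rewrite /= expr0n /= addr0 sqrtr_sqr. Qed.

Lemma Bmx_strongly_null (r u : R) x L : r != 0 -> u != 0 ->
  strongly_almost_conv_to x L ->
  strongly_almost_conv_to (Bmx r (- r) (- u) u x) 0.
Proof.
move=> r0 u0 /strongly_almost_conv_toP xL; apply/strongly_almost_conv_toP.
set e := fun k l => Normc.normc (x k l - L) in xL.
have e0 k l : 0 <= e k l by exact: normc_ge0.
pose e1 k l := if (0 < k)%N then e k.-1 l else 0.
pose e2 k l := if (0 < l)%N then e k l.-1 else 0.
pose e12 k l := if (0 < l)%N then e1 k l.-1 else 0.
have e10 k l : 0 <= e1 k l by rewrite /e1; case: ifP.
have e1N : uniformly_null _ e1 by exact: uniformly_null_shift1.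
have e2N : uniformly_null _ e2 by exact: uniformly_null_shift2.
have e12N : uniformly_null _ e12 by exact: uniformly_null_shift2.
(* Adding 1 keeps the factor positive when [L = 0], as [uniformly_nullZ] requires. *)
pose nL := Normc.normc L + 1.
have nL0 : 0 < nL by rewrite ltr_wpDl ?normc_ge0.
have ru0 : 0 < `|r * u| by rewrite normr_gt0 mulf_neq0.
(* The four shifts of |x - L| bound the mixed difference of x - L. The last term pays for the
   constant [L], whose mixed difference is [L] at the corner and 0 elsewhere; the whole column
   [l = 0] is a convenient null majorant of that corner. *)
apply: (@uniformly_null_le _ _ (fun k l => `|r * u| *
  ((e12 k l + e1 k l) + (e2 k l + e k l) + nL * (l == 0%N)%:R))); last first.
  apply: uniformly_nullZ => //; apply: uniformly_nullD.
    by apply: uniformly_nullD; apply: uniformly_nullD.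
  by apply: uniformly_nullZ => //; exact: uniformly_null_col0.
move=> k l; rewrite subr0 BmxE Normc.normcM normc_real normrN ler_pM2l //.
have nL_ge : Normc.normc L <= nL by rewrite lerDl.
rewrite /e12 /e1 /e2; case: k => [|k]; case: l => [|l] /=.
(* Only at the corner does a single entry of [x] remain, so that [L] is not cancelled. In the other
   three cases the signs of the remaining entries sum to 0, and [L] can be subtracted from each of
   them. *)
- rewrite !subr0 add0r !add0r mulr1 -{1}(subrK L (x 0%N 0%N)).
  by rewrite (le_trans (le_normcD _ _)) // lerD2l.
- rewrite [X in Normc.normc X](_ : _ = 0 - 0 - (x 0%N l - L) + (x 0%N l.+1 - L)
      :> R[i]).
    by rewrite (le_trans (normc_alt4_le _ _ _ _)) // Normc.normc0 mulr0 !addr0.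
  by ring.
- rewrite [X in Normc.normc X](_ : _ = 0 - (x k 0%N - L) - 0 + (x k.+1 0%N - L)
      :> R[i]).
    rewrite (le_trans (normc_alt4_le _ _ _ _)) // Normc.normc0 mulr1 !add0r.
    by rewrite lerDl ltW.
  by ring.
- rewrite [X in Normc.normc X](_ : _ = (x k l - L) - (x k l.+1 - L)
    - (x k.+1 l - L) + (x k.+1 l.+1 - L) :> R[i]); last by ring.
  by rewrite (le_trans (normc_alt4_le _ _ _ _)) // mulr0 addr0.
Qed.

End DifferenceMatrix.

(** The mixed difference is the composite of the differences in [k] and in [l], so it factors on
    products. Finding a preimage of a product thus splits into two one-variable problems. *)
Lemma mixed_diffM (K : comNzRingType) (a b : nat -> K) k l :
  (if (0 < k)%N && (0 < l)%N then a k.-1 * b l.-1 else 0)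
  - (if (0 < k)%N then a k.-1 * b l else 0)
  - (if (0 < l)%N then a k * b l.-1 else 0) + a k * b l =
  (a k - (if (0 < k)%N then a k.-1 else 0)) *
  (b l - (if (0 < l)%N then b l.-1 else 0)).
Proof. by case: (0 < k)%N; case: (0 < l)%N => /=; ring. Qed.

(** * The witness of strictness *)

Section AlternatingRows.
Variable R : realType.

Definition alt_rows : dseq R := fun k _ => (-1) ^+ k.

Lemma normc_sign k : Normc.normc ((-1) ^+ k : R[i]) = 1.
Proof.
elim: k => [|k IHk]; first by rewrite expr0 Normc.normc1.
by rewrite exprS mulN1r normcN.
Qed.

Lemma alt_rows_almost_null : almost_conv_to alt_rows 0.
Proof.
have sum_sign m q : Normc.normc (\sum_(m <= k < m + q) ((-1) ^+ k : R[i])) <= 1.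
  (* Consecutive signs cancel in pairs; an odd number of them leaves one sign, of modulus 1. *)
  have -> : \sum_(m <= k < m + q) ((-1) ^+ k : R[i]) = (odd q)%:R * (-1) ^+ m.
    elim: q => [|q IHq]; first by rewrite addn0 big_geq // mul0r.
    rewrite addnS big_nat_recr ?leq_addr //= IHq exprD.
    by rewrite -[(-1) ^+ q]signr_odd; case: (odd q) => /=; ring.
  rewrite Normc.normcM normc_sign mulr1.
  by case: odd; rewrite ?Normc.normc0 ?Normc.normc1.
apply/almost_conv_toP => e /natr_inv_small[N HN].
exists N => q q' Nq _ m n; rewrite subr0; apply: le_trans (HN q Nq).
have -> : window_mean alt_rows q q' m n =
    q.+1%:R^-1 * \sum_(m <= k < m + q.+1) (-1) ^+ k.
  rewrite /window_mean /alt_rows -!addnS.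
  under eq_bigr do rewrite sumr_const_nat addKn -mulr_natl.
  by rewrite -mulr_sumr natrM invfM -mulrA mulKf // pnatr_eq0.
rewrite Normc.normcM Normc.normcV normcMn Normc.normc1.
by rewrite ler_piMr // invr_ge0 ler0n.
Qed.

(* The windows based at rows 0 and 1 carry opposite signs, so whatever [L] is
   their means of [|x - L|] add up to at least 2. *)
Lemma alt_rows_not_strongly L : ~ strongly_almost_conv_to alt_rows L.
Proof.
move=> /strongly_almost_conv_toP /(_ 2^-1)[|N HN]; first by rewrite invr_gt0.
pose e k l := Normc.normc (alt_rows k l - L).
have : 2 <= window_mean e N N 0 0 + window_mean e N N 1 0.
  have -> : window_mean e N N 1 0 = window_mean (fun k l => e k.+1 l) N N 0 0.
    by rewrite /window_mean add1n big_add1.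
  rewrite -window_meanD -[leLHS](window_mean_cst _ _ N N 0 0).
  apply: le_window_mean => k l; rewrite /e /alt_rows.
  rewrite -[X in _ + X]normcN (le_trans _ (le_normcD _ _)) //.
  rewrite [X in Normc.normc X](_ : _ = (-1) ^+ k *+ 2 :> R[i]);
    last by rewrite exprS; ring.
  by rewrite normcMn normc_sign.
have := HN N N (leqnn N) (leqnn N) 0%N 0%N.
have := HN N N (leqnn N) (leqnn N) 1%N 0%N.
by rewrite -/e; lra.
Qed.

Lemma Bmx_alt_rows_strongly_null (r u : R) : r != 0 -> u != 0 ->
  strongly_almost_conv_to (Bmx r (- r) (- u) u alt_rows) 0.
Proof.
move=> r0 u0; apply/strongly_almost_conv_toP.
have ru0 : 0 < `|r * u| by rewrite normr_gt0 mulf_neq0.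
(* The rows are constant, so the difference in [l] vanishes for positive [l]; at [l = 0] at most two
   signs remain, whence the factor 2. *)
apply: (@uniformly_null_le _ _ (fun _ l => `|r * u| * (2 * (l == 0%N)%:R))).
  move=> k l; rewrite subr0 BmxE Normc.normcM normc_real normrN ler_pM2l //.
  rewrite /alt_rows; case: l => [|l] /=; last first.
    rewrite mulr0 [X in Normc.normc X](_ : _ = 0) ?Normc.normc0 //.
    by rewrite andbT; ring.
  rewrite andbF subr0 sub0r mulr1 (le_trans (le_normcD _ _)) //.
  rewrite normcN normc_sign; case: ifP => _; first by rewrite normc_sign.
  by rewrite Normc.normc0 add0r ler1n.
by do 2![apply: uniformly_nullZ => //]; exact: uniformly_null_col0.
Qed.

(* The preimage consists of the rescaled double partial sums of [alt_rows]:
   [Bmx] is, up to the factor [- (r * u)], the mixed difference operator. *)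
Lemma Bmx_alt_rows_preimage (r u : R) : r != 0 -> u != 0 ->
  exists x, Bmx r (- r) (- u) u x = alt_rows.
Proof.
move=> r0 u0; set c : R[i] := (- (r * u))%:C%C.
have c0 : c != 0 by rewrite /c fmorph_eq0 oppr_eq0 mulf_neq0.
(* The partial sums of the signs (-1)^k are 1, 0, 1, 0, ..., those of the constant 1 are [l.+1], and
   [c^-1] undoes the scalar factor of [Bmx]. *)
pose a k : R[i] := c^-1 * (~~ odd k)%:R; pose b l : R[i] := l.+1%:R.
exists (fun k l => a k * b l).
apply/funext => k; apply/funext => l; rewrite BmxE -/c mixed_diffM.
have -> : b l - (if (0 < l)%N then b l.-1 else 0) = 1.
  rewrite /b; case: l => [|l]; first by rewrite subr0.
  by rewrite ltn0Sn -[l.+2%:R]natr1 addrAC subrr add0r.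
rewrite mulr1 /alt_rows -signr_odd /a.
case: k => [|k]; first by rewrite ltnn subr0 mulr1 mulfV.
rewrite ltn0Sn -mulrBr mulVKf // oddS.
by case: (odd k); rewrite ?subr0 ?sub0r.
Qed.

End AlternatingRows.

Theorem theorem3p4 (R : realType) (r s t u : R)
    (r0 : r != 0) (s0 : s != 0) (t0 : t != 0) (u0 : u != 0)
    (hs : s = - r) (ht : t = - u) :
  [/\ @sCf R `<` Bdom r s t u (@sCf R),
      @sCf0 R `<` Bdom r s t u (@sCf0 R),
      Bdom r s t u (@sCf R) `<` Bdom r s t u (@Cf R) &
      Bdom r s t u (@sCf0 R) `<` Bdom r s t u (@Cf0 R)].
Proof.
rewrite hs ht; have [x Bx] := Bmx_alt_rows_preimage _ _ _ r0 u0; split; split.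
- by move=> y [L yL]; exists 0; exact: Bmx_strongly_null yL.
(* For the first two inclusions [alt_rows] itself is the separating sequence; for the last two it is
   the preimage [x]. *)
- move=> /(_ (alt_rows R))[|L]; last exact: alt_rows_not_strongly.
  by exists 0; exact: Bmx_alt_rows_strongly_null.
- by move=> y; exact: Bmx_strongly_null.
- move=> /(_ (alt_rows R)) sub; apply: alt_rows_not_strongly (sub _).
  exact: Bmx_alt_rows_strongly_null.
- by move=> y [L yL]; exists L; exact: strongly_almost_conv_to_almost.
- move=> /(_ x); rewrite /Bdom /= Bx => -[|L]; last exact: alt_rows_not_strongly.
  by exists 0; exact: alt_rows_almost_null.
- by move=> y; exact: strongly_almost_conv_to_almost.
- move=> /(_ x); rewrite /Bdom /= Bx => sub; apply: alt_rows_not_strongly (sub _).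
  exact: alt_rows_almost_null.
Qed.
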